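(* Let $G$ be a $2$-uniform linear oriented hypergraph (that is, a simple oriented signed graph) with maximum degree $\Delta(G)$. Then for every integer $k\ge\Delta(G)$ there exists a $k$-uniform linear oriented hypergraph $H_k$ with $\Lambda(H_k)=G$.
   Context: A hypergraph $(V,E,\mathcal I)$ consists of a finite set $V$ of vertices, a finite family $E=(e_\iota)_{\iota\in\Omega}$ of subsets of $V$ (the edges; an edge may be empty, and edges with different indices are regarded as different even if they coincide as sets) and its incidences $\mathcal I$. All hypergraphs are simple: each vertex $v\in e$ is incident with $e$ exactly once, so $\mathcal I=\{(v,e): v\in e\}$. A hypergraph is linear if $|e\cap f|\le 1$ for any two edges $e,f$ with distinct indices; it is $k$-uniform if every edge has exactly $k$ elements. The degree of a vertex is the number of edges containing it, and $\Delta$ is the maximum vertex degree. An oriented hypergraph is a hypergraph together with a map $\sigma:\mathcal I\to\{+1,-1\}$; hypergraph terminology for an oriented hypergraph refers to its underlying hypergraph. Intersection graph: for a linear oriented hypergraph $G$, $\Lambda(G)$ is the oriented hypergraph with vertex set $E(G)$ and one edge $ef=\{e,f\}$ for each pair of distinct $e,f\in E(G)$ with $e\cap f\ne\varnothing$; if $v\in e\cap f$ then $\sigma_{\Lambda(G)}(e,ef)=\sigma_G(v,e)$ and $\sigma_{\Lambda(G)}(f,ef)=\sigma_G(v,f)$. Equality of oriented hypergraphs means: same vertex set, and edge families that agree up to a bijective renaming of edges preserving the vertex sets of the edges and the orientation of each incidence. *)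

(* Defs.v *)
From mathcomp Require Import all_boot ssralg ssrint.

Set Implicit Arguments.
Unset Strict Implicit.
Unset Printing Implicit Defensive.

(* [edge] is a family, so distinct indices may carry the same subset of [V],
   and [E(H)] is identified with the index type [E].  Incidence of [v] with
   the edge of index [e] is [v \in edge H e]. *)
Record hypergraph (V E : finType) := Hypergraph { edge : E -> {set V} }.

Definition sign := {x : int | x \in [:: 1; -1]%R}.

Record ohypergraph (V E : finType) := OHypergraph {
  underlying :> hypergraph V E;
  orient : forall (v : V) (e : E), v \in edge underlying e -> sign
}.

Definition linear_hypergraph (V E : finType) (H : hypergraph V E) : Prop :=
  forall e f : E, e != f -> #|edge H e :&: edge H f| <= 1.

Definition uniform (k : nat) (V E : finType) (H : hypergraph V E) : Prop :=
  forall e : E, #|edge H e| = k.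

Definition degree (V E : finType) (H : hypergraph V E) (v : V) : nat :=
  #|[set e | v \in edge H e]|.

Definition max_degree (V E : finType) (H : hypergraph V E) : nat :=
  \max_(v : V) degree H v.

(* Sharing the vertex type [V] expresses equality of the vertex sets. *)
Definition ohypergraph_eq (V E1 E2 : finType)
    (G1 : ohypergraph V E1) (G2 : ohypergraph V E2) : Prop :=
  exists phi : E1 -> E2,
    [/\ bijective phi,
        forall e, edge G2 (phi e) = edge G1 e
      & forall v e (ve : v \in edge G1 e) (vphie : v \in edge G2 (phi e)),
          orient vphie = orient ve].

Section IntersectionGraph.

Variables V E : finType.

Definition meeting_pair (H : hypergraph V E) (A : {set E}) : bool :=
  [exists e, exists f,
    [&& e != f, edge H e :&: edge H f != set0 & A == [set e; f]]].

Definition Lambda_edge (H : hypergraph V E) : finType :=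
  {A : {set E} | meeting_pair H A}.

Definition Lambda_hypergraph (H : hypergraph V E) :
    hypergraph E (Lambda_edge H) :=
  Hypergraph (fun A : Lambda_edge H => val A).

Lemma meeting_pair_common (H : hypergraph V E) (A : Lambda_edge H) :
  exists v, v \in \bigcap_(e in val A) edge H e.
Proof.
case: A => A /= /existsP[e /existsP[f /and3P[_ /set0Pn[v]]]].
rewrite inE => /andP[ve vf] /eqP->; exists v.
by apply/bigcapP => g /set2P[] ->.
Qed.

(* For linear [H] this is the only vertex of [e :&: f], where [A] is the pair
   [{e, f}]; see [orient_Lambda]. *)
Definition common_vertex (H : hypergraph V E) (A : Lambda_edge H) : V :=
  xchoose (meeting_pair_common A).

Lemma common_vertexP (H : hypergraph V E) (e : E) (A : Lambda_edge H) :
  e \in edge (Lambda_hypergraph H) A -> common_vertex A \in edge H e.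
Proof. exact: (bigcapP (xchooseP (meeting_pair_common A))). Qed.

(* Only meaningful for linear [H]: otherwise two edges may share several
   vertices, carrying different orientations. *)
Definition Lambda (H : ohypergraph V E) : ohypergraph E (Lambda_edge H) :=
  @OHypergraph _ _ (Lambda_hypergraph H)
    (fun (e : E) (A : Lambda_edge H) eA => orient (common_vertexP eA)).

Lemma orient_Lambda (H : ohypergraph V E) (e f : E) (v : V)
    (A : Lambda_edge H) (eA : e \in edge (Lambda H) A) (ve : v \in edge H e) :
  linear_hypergraph H -> e != f -> v \in edge H f -> val A = [set e; f] ->
  orient eA = orient ve.
Proof.
move=> linH nef vf defA.
have fA : f \in edge (Lambda H) A by rewrite /= defA set22.
have Dv : common_vertex A = v.
  apply: (card_le1_eqP (linH e f nef)); first by rewrite in_setI ve vf.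
  by rewrite in_setI !common_vertexP.
rewrite /=; move: (common_vertexP eA); rewrite Dv => ve'.
by rewrite (bool_irrelevance ve' ve).
Qed.

End IntersectionGraph.

(* Main.v *)
Require Import Defs.
From mathcomp Require Import all_boot ssralg ssrint.

(** Take the dual of G: its vertices are the edges of G, and its edge indexed
    by [v] consists of the edges of G through [v].  Since G is linear, two dual
    edges share at most one vertex, and since every edge of G has two ends, the
    pairs of dual edges that do meet are exactly the edges of G.  The edge
    indexed by [v] has [degree G v <= k] vertices, and adding [k - degree G v]
    private vertices to it creates no new intersection. *)

Set Implicit Arguments.
Unset Strict Implicit.
Unset Printing Implicit Defensive.

Lemma card_ord_lt k m : m <= k -> #|[set i : 'I_k | i < m]| = m.
Proof.
move=> le_mk; rewrite -sum1dep_card.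
by rewrite (big_ord_narrow le_mk) sum1_card card_ord.
Qed.

Section PaddedDual.

Variables (V E : finType) (G : ohypergraph V E) (k : nat).

(* The vertices [inr (v, i)] with [k - degree G v <= i] remain isolated. *)
Definition padded_dual_hypergraph : hypergraph (E + V * 'I_k)%type V :=
  Hypergraph (fun v => [set w : E + V * 'I_k | match w with
    | inl e => v \in edge G e
    | inr p => (p.1 == v) && (p.2 < k - degree G v)
    end]).

Lemma mem_dual_inl e v :
  (inl e \in edge padded_dual_hypergraph v) = (v \in edge G e).
Proof. by rewrite inE. Qed.

Lemma mem_dual_inr p v :
  (inr p \in edge padded_dual_hypergraph v) =
  (p.1 == v) && (p.2 < k - degree G v).
Proof. by rewrite inE. Qed.

(** The sign of [v] in [e] is carried over unchanged. A private vertex lies on at most one edge, so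
    its sign never reaches [Lambda] and the value 1 is arbitrary. *)
Definition padded_dual : ohypergraph (E + V * 'I_k)%type V :=
  @OHypergraph _ _ padded_dual_hypergraph
    (fun w v => match w return w \in edge padded_dual_hypergraph v -> sign with
      | inl e => fun ev => orient (etrans (esym (mem_dual_inl e v)) ev)
      | inr _ => fun _ => exist _ 1%R (mem_head _ _)
      end).

Lemma padded_dual_uniform : max_degree G <= k -> uniform k padded_dual.
Proof.
move=> leDk v.
have deg_le : degree G v <= k := leq_trans (leq_bigmax v) leDk.
have -> : edge padded_dual v = inl @: [set e | v \in edge G e] :|:
    inr @: setX [set v] [set i : 'I_k | i < k - degree G v].
  apply/setP=> -[e | [u i]]; rewrite in_setU (mem_dual_inl, mem_dual_inr) /=.
    rewrite mem_imset ?inE; last exact: inl_inj.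
    by case: imsetP => [[]//|_]; rewrite orbF.
  rewrite [X in _ || X]mem_imset ?inE; last exact: inr_inj.
  by case: imsetP => [[]|].
rewrite cardsU (_ : _ :&: _ = set0) ?cards0 ?subn0; last first.
  by apply/setP=> w; rewrite !inE; apply/andP=> -[/imsetP[e _ ->] /imsetP[]].
rewrite !card_imset; [|exact: inr_inj|exact: inl_inj].
by rewrite cardsX cards1 mul1n card_ord_lt ?leq_subr // subnKC.
Qed.

(** A private vertex records in its first component the only edge that can contain it, so two
    distinct edges share only vertices that come from edges of [G]. *)
Lemma padded_dual_common u v w :
  u != v -> w \in edge padded_dual u -> w \in edge padded_dual v ->
  exists2 e, w = inl e & [set u; v] \subset edge G e.
Proof.
case: w => [e | p] neq_uv.
  rewrite !mem_dual_inl => ue ve; exists e => //.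
  by rewrite subUset !sub1set ue ve.
rewrite !mem_dual_inr => /andP[/eqP pu _] /andP[/eqP pv _].
by rewrite -pu pv eqxx in neq_uv.
Qed.

Hypothesis linG : linear_hypergraph G.

(** Distinct indices would put all of [A] into an intersection of size at most 1. *)
Lemma linear_edge_inj (A : {set V}) e f :
  1 < #|A| -> A \subset edge G e -> A \subset edge G f -> e = f.
Proof.
move=> A_gt1 Ae Af; apply/eqP/contraT=> /linG; rewrite leqNgt => /negP[].
by apply: leq_trans A_gt1 (subset_leq_card _); rewrite subsetI Ae Af.
Qed.

Lemma padded_dual_linear : linear_hypergraph padded_dual.
Proof.
move=> u v neq_uv; apply/card_le1_eqP=> w w'.
rewrite !in_setI => /andP[wu wv] /andP[w'u w'v].
have [e -> uve] := padded_dual_common neq_uv wu wv.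
have [f -> uvf] := padded_dual_common neq_uv w'u w'v.
by rewrite (linear_edge_inj _ uve uvf) // cards2 neq_uv.
Qed.

Hypothesis unifG : uniform 2 G.

Lemma meeting_pair_edge (A : {set V}) :
  meeting_pair padded_dual A -> exists e, edge G e == A.
Proof.
case/existsP=> u /existsP[v /and3P[neq_uv /set0Pn[w] wuv /eqP->]].
have [wu wv] := setIP wuv.
have [e _ uve] := padded_dual_common neq_uv wu wv.
(* The inclusion of the pair in [edge G e] is an equality, as both sets have two elements. *)
by exists e; rewrite eq_sym eqEcard uve unifG cards2 neq_uv.
Qed.

Lemma edge_meeting_pair e : meeting_pair padded_dual (edge G e).
Proof.
have /eqP/cards2P[u [v [neq_uv De]]] := unifG e.
apply/existsP; exists u; apply/existsP; exists v; rewrite neq_uv De eqxx andbT.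
by apply/set0Pn; exists (inl e); rewrite in_setI !mem_dual_inl De set21 set22.
Qed.

Lemma Lambda_padded_dual : ohypergraph_eq (Lambda padded_dual) G.
Proof.
pose phi (A : Lambda_edge padded_dual) := xchoose (meeting_pair_edge (valP A)).
have edge_phi A : edge G (phi A) = val A.
  exact: eqP (xchooseP (meeting_pair_edge (valP A))).
pose psi e : Lambda_edge padded_dual := Sub (edge G e) (edge_meeting_pair e).
exists phi; split=> //.
  exists psi => [A | e]; first by apply: val_inj; rewrite /= edge_phi.
  have Dphi : edge G (phi (psi e)) = edge G e by rewrite edge_phi.
  (* Linearity excludes parallel edges of size 2, so the vertex set determines the index. *)
  by apply: (@linear_edge_inj (edge G e)); rewrite ?Dphi ?unifG.
move=> v A vA vphi.
have /existsP[a /existsP[b /and3P[neq_ab _ /eqP DA]]] := valP A.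
(* The pair [A] is unordered; name its ends so that [v] comes first, as [orient_Lambda] expects. *)
have [u neq_vu Dvu] : exists2 u, v != u & val A = [set v; u].
  have : v \in val A by [].
  rewrite DA => /set2P[]->; [exists b | exists a] => //; first by rewrite eq_sym.
  by rewrite setUC.
have v_dual : inl (phi A) \in edge padded_dual v by rewrite mem_dual_inl.
have u_dual : inl (phi A) \in edge padded_dual u.
  by rewrite mem_dual_inl edge_phi Dvu set22.
(* The dual edges [v] and [u] meet in [inl (phi A)], whose sign in [v] is by construction that of
   [v] in [phi A]; only the membership proofs differ. *)
rewrite (orient_Lambda vA v_dual padded_dual_linear neq_vu u_dual Dvu) /=.
by congr orient; apply: bool_irrelevance.
Qed.

End PaddedDual.

Theorem theorem3p5 (V E : finType) (G : ohypergraph V E) :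
  linear_hypergraph G -> uniform 2 G ->
  forall k : nat, max_degree G <= k ->
  exists (W : finType) (H : ohypergraph W V),
    [/\ uniform k H, linear_hypergraph H & ohypergraph_eq (Lambda H) G].
Proof.
move=> linG unifG k leDk; exists (E + V * 'I_k)%type, (padded_dual G k).
split; first exact: padded_dual_uniform.
  exact: padded_dual_linear.
exact: Lambda_padded_dual.
Qed.
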